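(* For one-sided matching with unit-sum valuations, the algorithm FirstPositionAdaptive (FPA) makes at most two value queries per agent and has distortion $O(n^{2/3}\sqrt{\log n})$.
   Context: One-sided matching: there is a set $N$ of $n$ agents and a set $A$ of $n$ items. Each agent $i$ has a valuation function $v_i:A\to\mathbb{R}_{\ge0}$ with $\sum_j v_i(j)=1$. Agents report strict rankings consistent with values (if $a\succ_i b$ then $v_i(a)\ge v_i(b)$), and value queries return $v_i(j)$. A matching is a bijection $N\to A$ with welfare $\sum_i v_i(y_i)$. Distortion is the supremum over unit-sum profiles of optimal welfare divided by the welfare of the output. Assume $n$ is such that $n^{1/3}$ and $\frac14 n^{1/3}$ are integers. ''Position $\ell$'' of agent $i$ refers to the $\ell$-th item in $\succ_i$. Algorithm FPA: - Query every agent $i$ for her top item $j_i^*$; let $v_i^*$ be its value. All agents start active. - Case 1: $\max_i v_i^*\ge n^{-1/3}$. For $\ell=1,\dots,n$ in order: while there exists a partial matching $Y_p$ of size at least $n^{1/3}/\sqrt{\log n}$ that matches active agents $i$ to distinct items $y_i$ which $i$ ranks at some position $\le\ell$, query each such $i$ for $y_i$ and make these agents inactive (ties broken arbitrarily). Then output a matching maximizing welfare with respect to the revealed values, where unqueried pairs count as $0$. - Case 2: $\max_i v_i^*<n^{-1/3}$. Query each agent $i$ for the item at position $n^{1/3}+1$; call its value $u_i$. Define $\tilde v_i(j_i^* )=v_i^*$, $\tilde v_i(j)=u_i$ for items at positions $2,\dots,n^{1/3}+1$, and $\tilde v_i(j)=0$ for items at positions $\ge n^{1/3}+2$. For every agent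 with $u_i<\frac12 n^{-1}$, redefine $\tilde v_i(j)=\frac13 n^{-1/3}$ for items at positions $2,\dots,\frac14 n^{1/3}$. Output a matching maximizing $\sum_i\tilde v_i(y_i)$. *)

(* Defs.v *)
From HB Require Import structures.
From mathcomp Require Import all_boot all_order all_algebra all_fingroup.
From mathcomp Require Import reals exp.
Set Implicit Arguments. Unset Strict Implicit. Unset Printing Implicit Defensive.
Import Order.TTheory GRing.Theory Num.Theory.
Local Open Scope ring_scope.

(* Agents and items are both indexed by 'I_n.
   A ranking of agent i is a permutation [sigma i : {perm 'I_n}] mapping a
   0-based position p (position p+1 in the paper) to the item ranked there. *)

Section FPA.
Variable R : realType.
Variable n : nat.

Definition agent := 'I_n.
Definition item := 'I_n.

Definition rank (s : {perm 'I_n}) (j : item) : nat := val (s^-1%g j).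

(* value of the item at 0-based rank p (0 if there is none) *)
Definition val_at (vi : item -> R) (s : {perm 'I_n}) (p : nat) : R :=
  \sum_(j | rank s j == p) vi j.

Definition unit_sum (v : agent -> item -> R) : Prop :=
  (forall i j, 0 <= v i j) /\ (forall i, \sum_j v i j = 1).

Definition consistent (v : agent -> item -> R) (sigma : agent -> {perm 'I_n}) :=
  forall i (p q : 'I_n), (p < q)%N -> v i (sigma i q) <= v i (sigma i p).

Definition welfare (f : agent -> item -> R) (y : {perm 'I_n}) : R :=
  \sum_i f i (y i).

Definition maximizes (f : agent -> item -> R) (y : {perm 'I_n}) : Prop :=
  forall y' : {perm 'I_n}, welfare f y' <= welfare f y.

Definition revealed (v : agent -> item -> R) (Q : seq (agent * item))
  : agent -> item -> R :=
  fun i j => if (i, j) \in Q then v i j else 0.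

Definition nqueries (Q : seq (agent * item)) (i : agent) : nat :=
  count (fun q => q.1 == i) Q.

Definition queries_at (sigma : agent -> {perm 'I_n}) (p : nat)
  : seq (agent * item) :=
  [seq (i, j) | i <- enum 'I_n, j <- [seq j <- enum 'I_n | rank (sigma i) j == p]].

(* a partial matching of active agents (in A) to distinct items, each item
   ranked by its agent at some position <= l (i.e. 0-based rank < l) *)
Definition valid_pm (sigma : agent -> {perm 'I_n}) (A : {set agent}) (l : nat)
  (P : seq (agent * item)) : Prop :=
  [/\ uniq (map fst P), uniq (map snd P),
      all (fun q => q.1 \in A) P &
      all (fun q => (rank (sigma q.1) q.2 < l)%N) P].

(* The loop of Case 1.  [c1loop sigma T l A Q] : starting at position l with
   active set A, a run of the loop (with arbitrary tie-breaking) issues the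
   queries Q (in order). T is the size threshold n^{1/3}/sqrt(log n). *)
Inductive c1loop (sigma : agent -> {perm 'I_n}) (T : R)
  : nat -> {set agent} -> seq (agent * item) -> Prop :=
| c1_done A : c1loop sigma T n.+1 A [::]
| c1_query l A P Q :
    (1 <= l <= n)%N -> valid_pm sigma A l P -> T <= (size P)%:R ->
    c1loop sigma T l (A :\: [set q.1 | q in P]) Q ->
    c1loop sigma T l A (P ++ Q)
| c1_next l A Q :
    (1 <= l <= n)%N ->
    ~ (exists P, valid_pm sigma A l P /\ T <= (size P)%:R) ->
    c1loop sigma T l.+1 A Q ->
    c1loop sigma T l A Q.

(* Case 2 proxy valuation; k = n^{1/3}. *)
Definition vtilde (k : nat) (v : agent -> item -> R)
  (sigma : agent -> {perm 'I_n}) : agent -> item -> R :=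
  fun i j =>
    let vstar := val_at (v i) (sigma i) 0 in
    let u := val_at (v i) (sigma i) k in
    let r := rank (sigma i) j in
    if r == 0%N then vstar
    else if (r <= k)%N then
      (if (u < (2 * n%:R)^-1) && (r < k %/ 4)%N then (3 * k%:R)^-1 else u)
    else 0.

(* [FPA k v sigma Q y]: some run of algorithm FPA (with k = n^{1/3}, any
   tie-breaking and any choice of maximizing matching) on profile (v, sigma)
   issues the value queries Q (with repetitions) and outputs the matching y. *)
Definition FPA (k : nat) (v : agent -> item -> R)
  (sigma : agent -> {perm 'I_n}) (Q : seq (agent * item)) (y : {perm 'I_n})
  : Prop :=
  let Q0 := queries_at sigma 0 in
  let T := k%:R / Num.sqrt (ln n%:R) in
  ((exists i, k%:R^-1 <= val_at (v i) (sigma i) 0) /\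
   exists Q1, [/\ c1loop sigma T 1 setT Q1, Q = Q0 ++ Q1 &
                  maximizes (revealed v Q) y])
  \/
  ((forall i, val_at (v i) (sigma i) 0 < k%:R^-1) /\
   Q = Q0 ++ queries_at sigma k /\ maximizes (vtilde k v sigma) y).

End FPA.

(* Main.v *)
Require Import Defs.
From HB Require Import structures.
From mathcomp Require Import all_boot all_order all_algebra all_fingroup.
From mathcomp Require Import reals exp.
From mathcomp Require Import ring lra zify.
Import Order.TTheory GRing.Theory Num.Theory.
Local Open Scope ring_scope.

(** In Case 1, charge an arbitrary matching [y'] against the run of the loop. An
agent queried before position [rank (y' i)] is passed has revealed at least
[v i (y' i)], and there are at most [n / T = k^2 sqrt (ln n)] batches, each worth
at most the output. The other agents number fewer than [T] at each position [l],
where values are at most [1 / l]; they contribute at most [T (1 + ln n)], which is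
[O(k sqrt (ln n))], while the output is worth at least [1 / k].

In Case 2, [vtilde] is a pointwise lower bound of [v], and the best matching for
[vtilde] is worth at least the average over the [n] cyclic matchings,
[(sum_(i, j) vtilde i j) / n]. Agent by agent,
[v i (y' i) <= 2 k^2 vtilde i (y' i) + (12 / k) sum_j vtilde i j]. *)

(** * Ranks and values by position *)

Lemma rank_perm (n : nat) (s : {perm 'I_n}) (p : 'I_n) : rank s (s p) = p.
Proof. by rewrite /rank permK. Qed.

Lemma rank_lt (n : nat) (s : {perm 'I_n}) (j : 'I_n) : (rank s j < n)%N.
Proof. exact: ltn_ord. Qed.

Lemma rank_inj (n : nat) (s : {perm 'I_n}) : injective (rank s).
Proof. by move=> j j' /val_inj /perm_inj. Qed.

Lemma val_at_rank (R : realType) (n : nat) (f : 'I_n -> R) (s : {perm 'I_n})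
  (j : 'I_n) : val_at f s (rank s j) = f j.
Proof.
rewrite /val_at (big_pred1 j) // => j' /=.
by rewrite (inj_eq (@rank_inj n s)).
Qed.

Lemma val_at_perm (R : realType) (n : nat) (f : 'I_n -> R) (s : {perm 'I_n})
  (p : 'I_n) : val_at f s p = f (s p).
Proof. by rewrite -(val_at_rank R n f s) rank_perm. Qed.

Lemma val_at_ge0 (R : realType) (n : nat) (f : 'I_n -> R) (s : {perm 'I_n})
  (p : nat) : (forall j, 0 <= f j) -> 0 <= val_at f s p.
Proof. by move=> f0; rewrite /val_at sumr_ge0. Qed.

Lemma val_at_mono (R : realType) (n : nat) (v : 'I_n -> 'I_n -> R)
  (sigma : 'I_n -> {perm 'I_n}) (i : 'I_n) (p q : nat) :
  (forall j, 0 <= v i j) -> consistent v sigma -> (p <= q)%N ->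
  val_at (v i) (sigma i) q <= val_at (v i) (sigma i) p.
Proof.
move=> v0 cons; rewrite leq_eqVlt => /predU1P[-> //|pq].
have [qn|nq] := ltnP q n.
  have := cons i (Ordinal (ltn_trans pq qn)) (Ordinal qn) pq.
  by rewrite -!val_at_perm.
(* No item has rank [q >= n], so [val_at] takes its default value 0 there. *)
apply: le_trans (val_at_ge0 _ _ _ _ _ v0).
rewrite /val_at big_pred0 // => j; apply/negbTE.
by rewrite neq_ltn (leq_trans (rank_lt n _ j) nq).
Qed.

Lemma sum_val_at (R : realType) (n : nat) (f : 'I_n -> R) (s : {perm 'I_n}) :
  \sum_(0 <= p < n) val_at f s p = \sum_j f j.
Proof.
rewrite big_mkord [RHS](reindex_perm s); apply: eq_bigr => p _.
exact: val_at_perm.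
Qed.

Lemma sum_block_le (R : realType) (F : nat -> R) (a b : nat) (c : R) :
  (a <= b)%N -> (forall p, (a <= p < b)%N -> F p <= c) ->
  \sum_(a <= p < b) F p <= (b%:R - a%:R) * c.
Proof.
move=> ab le_c; rewrite -natrB //.
apply: le_trans (ler_sum_nat le_c) _.
by rewrite sumr_const_nat mulr_natl.
Qed.

Lemma top_block_le_sum (R : realType) (n : nat) (f : 'I_n -> R)
  (s : {perm 'I_n}) (m : nat) (c : R) :
  (m <= n)%N -> (forall j, 0 <= f j) ->
  (forall j, (rank s j < m)%N -> c <= f j) -> m%:R * c <= \sum_j f j.
Proof.
move=> mn f0 le_c; rewrite -(sum_val_at R n f s) (big_cat_nat _ mn) //=.
rewrite -[leLHS]addr0 lerD ?sumr_ge0 //; last first.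
  by move=> p _; apply: val_at_ge0.
rewrite mulr_natl -[m in c *+ m]subn0 -sumr_const_nat.
apply: ler_sum_nat => p /andP[_ pm].
have := rank_perm n s (Ordinal (leq_trans pm mn)) => /= rp.
by rewrite -{1}rp val_at_rank; apply: le_c; rewrite rp.
Qed.

(** Item [j] and all items ranked above it are each worth at least [v i j], and together they are
    worth at most 1. *)
Lemma value_le_inv_rank (R : realType) (n : nat) (v : 'I_n -> 'I_n -> R)
  (sigma : 'I_n -> {perm 'I_n}) (i j : 'I_n) :
  unit_sum v -> consistent v sigma ->
  v i j <= ((rank (sigma i) j).+1)%:R^-1.
Proof.
move=> [v0 v1] cons.
rewrite -[leRHS]mul1r ler_pdivlMr ?ltr0Sn // mulrC -[leRHS](v1 i).
apply: (top_block_le_sum R n (v i) (sigma i)) => //; first exact: rank_lt.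
move=> j' le_r; rewrite -(val_at_rank R n (v i) (sigma i) j).
by rewrite -(val_at_rank R n (v i) (sigma i) j') val_at_mono.
Qed.

(** * Averaging over matchings and extending partial ones *)

Lemma maximizes_average (R : realType) (n : nat) (f : 'I_n -> 'I_n -> R)
  (y : {perm 'I_n}) :
  maximizes f y -> \sum_i \sum_j f i j <= n%:R * welfare f y.
Proof.
case: n f y => [|m] f y ymax; first by rewrite big_ord0 mul0r.
(* The cyclic matchings [i |-> i + j] modulo [m.+1] cover every pair of an agent and an item exactly
   once. *)
pose sh (j : 'I_m.+1) : {perm 'I_m.+1} := perm (@addIr _ j).
have -> : \sum_i \sum_j f i j = \sum_j welfare f (sh j).
  rewrite /welfare exchange_big /= [RHS]exchange_big /= exchange_big /=.
  apply: eq_bigr => i _; rewrite (reindex_inj (addrI i)) /=.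
  by apply: eq_bigr => j _; rewrite /sh permE.
apply: le_trans (ler_sum _ (fun j _ => ymax (sh j))) _.
by rewrite sumr_const card_ord mulr_natl.
Qed.

(** Induction on [P]: following [y] by the swap of [y a] and [b] sends [a] to [b], and by
    distinctness it moves the image of no agent in the tail. *)
Lemma partial_matching_extends (n : nat) (P : seq ('I_n * 'I_n)) :
  uniq (map fst P) -> uniq (map snd P) ->
  exists y : {perm 'I_n}, forall q, q \in P -> y q.1 = q.2.
Proof.
elim: P => [|[a b] P IH] /=; first by exists 1%g.
move=> /andP[aP uP1] /andP[bP uP2]; have [y yP] := IH uP1 uP2.
exists (y * tperm (y a) b)%g => q; rewrite inE => /predU1P[->|qP] /=.
  by rewrite permM tpermL.
rewrite permM tpermD ?yP //.
  rewrite -yP // (inj_eq perm_inj); apply: contraNneq aP => ->.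
  exact: map_f.
by apply: contraNneq bP => ->; apply: map_f.
Qed.

Lemma revealed_ge0 (R : realType) (n : nat) (v : 'I_n -> 'I_n -> R) Q i j :
  (forall i j, 0 <= v i j) -> 0 <= revealed v Q i j.
Proof. by move=> v0; rewrite /revealed; case: ifP. Qed.

(** A matching made of queried pairs can be extended to a permutation without loss, since revealed
    values are nonnegative. The output beats it in revealed welfare, which never exceeds true
    welfare. *)
Lemma partial_matching_le (R : realType) (n : nat) (v : 'I_n -> 'I_n -> R)
  (Q P : seq ('I_n * 'I_n)) (y : {perm 'I_n}) :
  (forall i j, 0 <= v i j) -> maximizes (revealed v Q) y ->
  uniq (map fst P) -> uniq (map snd P) -> {subset P <= Q} ->
  \sum_(q <- P) v q.1 q.2 <= welfare v y.
Proof.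
move=> v0 ymax u1 u2 PQ.
have [z zP] := partial_matching_extends n P u1 u2.
apply: (@le_trans _ _ (welfare (revealed v Q) y)); last first.
  by apply: ler_sum => i _; rewrite /revealed; case: ifP.
apply: le_trans (ymax z).
rewrite big_seq (eq_bigr (fun q => revealed v Q q.1 (z q.1))); last first.
  by move=> q qP; rewrite zP // /revealed -surjective_pairing PQ.
rewrite -big_seq -(big_map fst xpredT (fun i => revealed v Q i (z i))).
rewrite big_uniq // /welfare [leRHS](bigID (mem (map fst P))) /=.
by rewrite lerDl sumr_ge0 // => i _; apply: revealed_ge0.
Qed.

(** * Number of queries per agent *)

Lemma nqueries_cat (n : nat) (Q Q' : seq ('I_n * 'I_n)) (i : 'I_n) :
  nqueries (Q ++ Q') i = (nqueries Q i + nqueries Q' i)%N.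
Proof. exact: count_cat. Qed.

Lemma nqueries_uniq (n : nat) (P : seq ('I_n * 'I_n)) (i : 'I_n) :
  uniq (map fst P) -> nqueries P i = (i \in map fst P).
Proof.
move=> u; rewrite -(count_uniq_mem _ u) count_map.
by apply: eq_count => q /=.
Qed.

Lemma nqueries_at_le1 (n : nat) (sigma : 'I_n -> {perm 'I_n}) (p : nat)
  (i : 'I_n) : (nqueries (queries_at sigma p) i <= 1)%N.
Proof.
rewrite nqueries_uniq ?leq_b1 //.
have inj2 : {in queries_at sigma p &, injective fst}.
  move=> q q' /allpairsPdep[a [b [_ + ->]]] /allpairsPdep[a' [b' [_ + ->]]] /=.
  rewrite !mem_filter => /andP[/eqP rb _] /andP[/eqP rb' _] aa'.
  by subst a'; congr pair; apply: (rank_inj n (sigma a)); rewrite rb rb'.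
rewrite map_inj_in_uniq // /queries_at.
apply: allpairs_uniq_dep => [|a _|]; first exact: enum_uniq.
  by apply: filter_uniq; apply: enum_uniq.
by move=> [a b] [a' b'] _ _ /= [-> ->].
Qed.

Lemma mem_queries_at (n : nat) (sigma : 'I_n -> {perm 'I_n}) (i j : 'I_n) :
  (i, j) \in queries_at sigma (rank (sigma i) j).
Proof.
apply/allpairsPdep; exists i, j; split=> //; first by rewrite mem_enum.
by rewrite mem_filter eqxx mem_enum.
Qed.

(** Bounding by membership in [A] rather than by 1 carries the induction: the agents of a batch
    leave the active set, so they are not queried later. *)
Lemma nqueries_c1loop (R : realType) (n : nat) (sigma : 'I_n -> {perm 'I_n})
  (T : R) l (A : {set 'I_n}) Q (i : 'I_n) :
  c1loop sigma T l A Q -> (nqueries Q i <= (i \in A))%N.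
Proof.
elim=> {l A Q} [//|l A P Q _ [u1 _ /allP PA _] _ _ IH|//].
rewrite nqueries_cat nqueries_uniq //.
move: IH; rewrite inE; case: imsetP => [[q qP ->]|nP] /=; last first.
  case: (boolP (i \in map fst P)) => [/mapP[q qP iq]|_] //.
  by case: nP; exists q.
by rewrite (map_f fst qP) (PA q qP); case: nqueries.
Qed.

(** * Welfare accounting along the loop of Case 1 *)

Lemma card_setD_agents (n : nat) (A : {set 'I_n}) (P : seq ('I_n * 'I_n)) :
  uniq (map fst P) -> all (fun q => q.1 \in A) P ->
  (#|A :\: [set q.1 | q in P]| + size P = #|A|)%N.
Proof.
move=> u1 /allP PA; set D := [set _ | _ in _].
have DA : D \subset A by apply/subsetP => i /imsetP[q qP ->]; apply: PA.
have -> : size P = #|D|.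
  rewrite -(size_map fst) -(card_uniqP u1); apply: eq_card => i.
  by apply/mapP/imsetP => -[q qP ->]; exists q.
by rewrite cardsD (setIidPr DA) subnK // subset_leq_card.
Qed.

(** Induction along the run; [B] will be the welfare of the output. A batch removes at least [T]
    agents from [A], so [#|A| / T * B] drops by at least [B], which pays for the batch. Moving past
    position [h] is paid for by the term [T / h]. *)
Lemma c1loop_welfare (R : realType) (n : nat) (v : 'I_n -> 'I_n -> R)
  (sigma : 'I_n -> {perm 'I_n}) (y' : {perm 'I_n}) (T B : R) l
  (A : {set 'I_n}) Q :
  0 < T -> unit_sum v -> consistent v sigma -> c1loop sigma T l A Q ->
  (forall P, uniq (map fst P) -> uniq (map snd P) -> {subset P <= Q} ->
     \sum_(q <- P) v q.1 q.2 <= B) ->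
  \sum_(i in A | (l <= (rank (sigma i) (y' i)).+1)%N) v i (y' i)
    <= #|A|%:R / T * B + \sum_(l <= h < n.+1) T / h%:R.
Proof.
move=> T0 us cons; elim=> {l A Q}.
- move=> A leB; rewrite big_pred0 => [|i]; last first.
    by rewrite ltnNge rank_lt andbF.
  rewrite big_geq // addr0 mulr_ge0 ?divr_ge0 ?ler0n ?(ltW T0) //.
  by have := leB [::] isT isT; rewrite big_nil; apply.
- move=> l A P Q ln [u1 u2 PA Pl] szP _ IH leB.
  have leP : \sum_(q <- P) v q.1 q.2 <= B.
    by apply: leB => // q qP; rewrite mem_cat qP.
  have {}IH := IH (fun P' v1 v2 sub =>
    leB P' v1 v2 (fun q qP => mem_subseq (suffix_subseq P Q) (sub q qP))).
  have B0 : 0 <= B by have := leB [::] isT isT; rewrite big_nil; apply.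
  have cardA := card_setD_agents n A P u1 PA.
  have memD i : (i \in [set q.1 | q in P]) = (i \in map fst P).
    by apply/imsetP/mapP => -[q qP ->]; exists q.
  have batch : \sum_(i | (i \in A) && (l <= (rank (sigma i) (y' i)).+1)%N
                         && (i \in map fst P)) v i (y' i) <= B.
    apply: le_trans leP; rewrite big_mkcondl -big_uniq // big_map.
    rewrite big_seq [leRHS]big_seq; apply: ler_sum => q qP.
    case: ifP => [/andP[_ lr]|_]; last exact: us.1.
    (* The queried item has rank below [l] and the item in [y'] has rank at least [l - 1], so the
       queried one is worth at least as much. *)
    rewrite -(val_at_rank R n _ (sigma q.1) (y' q.1)).
    rewrite -(val_at_rank R n _ (sigma q.1) q.2).
    apply: val_at_mono cons _ => [j|]; first exact: us.1.
    by rewrite -ltnS; apply: leq_trans lr; apply: (allP Pl).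
  rewrite (bigID (fun i => i \in map fst P)) /=.
  rewrite [X in _ + X](eq_bigl (fun i => (i \in A :\: [set q.1 | q in P]) &&
    (l <= (rank (sigma i) (y' i)).+1)%N)); last first.
    by move=> i; rewrite inE memD andbC andbA.
  apply: le_trans (lerD batch IH) _; rewrite addrA lerD2r -cardA natrD.
  rewrite mulrDl mulrDl addrC lerD2l ler_peMl //.
  by rewrite ler_pdivlMr // mul1r.
- move=> l A Q /andP[l1 ln] nP _ IH leB; have {}IH := IH leB.
  (* Restricted to the active agents whose item sits exactly at position [l], [y'] is a valid
     partial matching. As no valid one has size [T] or more, these agents are few. *)
  pose X := [set i in A | (rank (sigma i) (y' i)).+1 == l].
  have X_lt : #|X|%:R <= T.
    rewrite leNgt; apply/negP => ltX; apply: nP.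
    exists [seq (i, y' i) | i <- enum X]; split; last first.
      by rewrite size_map -cardE ltW.
    split.
    - by rewrite -map_comp map_id enum_uniq.
    - by rewrite -map_comp (map_inj_uniq perm_inj) enum_uniq.
    - apply/allP => q /mapP[i]; rewrite mem_enum inE => /andP[iA _] ->.
      exact: iA.
    - apply/allP => q /mapP[i]; rewrite mem_enum inE => /andP[_ /eqP <-] -> /=.
      exact: ltnSn.
  have levelX : \sum_(i in X) v i (y' i) <= T / l%:R.
    apply: (@le_trans _ _ (\sum_(i in X) l%:R^-1)).
      apply: ler_sum => i; rewrite inE => /andP[_ /eqP <-].
      exact: value_le_inv_rank.
    by rewrite sumr_const -(mulr_natl _ #|X|) ler_wpM2r // invr_ge0.
  rewrite (bigID (mem X)) /= big_ltn // [leRHS]addrCA; apply: lerD.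
    apply: le_trans levelX; rewrite le_eqVlt; apply/orP; left; apply/eqP.
    by apply: eq_bigl => i; rewrite inE; case: (i \in A) => //=; lia.
  apply: le_trans IH; rewrite le_eqVlt; apply/orP; left; apply/eqP.
  by apply: eq_bigl => i; rewrite inE; case: (i \in A) => //=; lia.
Qed.

(** * Logarithm estimates *)

Lemma harmonic_le_ln (R : realType) (n : nat) :
  \sum_(1 <= h < n.+2) h%:R^-1 <= 1 + ln n.+1%:R :> R.
Proof.
elim: n => [|n IH]; first by rewrite big_nat1 invr1 ln1 addr0.
rewrite big_nat_recr //=; apply: le_trans (lerD IH (lexx _)) _.
rewrite -addrA lerD2l -lerBrDl.
have n2 : 0 < n.+2%:R :> R by rewrite ltr0n.
have n1 : 0 < n.+1%:R :> R by rewrite ltr0n.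
(* The increment is bounded by [ln (1 + x) <= x] at [x = - 1 / (n + 2)]. *)
have := @le_ln1Dx R (- n.+2%:R^-1); rewrite ltrN2 invf_lt1 // ltr1n => /(_ isT).
have -> : 1 + - n.+2%:R^-1 = n.+1%:R / n.+2%:R :> R.
  have -> : n.+1%:R = n.+2%:R - 1 :> R by rewrite -(natr1 n.+1) addrK.
  by rewrite mulrBl divff ?gt_eqF // mul1r.
by rewrite ln_div ?posrE // lerNr opprB.
Qed.

(** [ln 4 = 2 ln 2], and [ln 2 >= 1 / 2] comes from [ln (1 + x) <= x] at [x = - 1 / 2]. This makes
    [sqrt (ln n)] at least 1 and absorbs [1 + ln n] into [2 ln n]. *)
Lemma ln_ge1 (R : realType) (n : nat) : (4 <= n)%N -> 1 <= ln n%:R :> R.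
Proof.
move=> n4.
have ln2 : 2^-1 <= ln 2 :> R.
  have := @le_ln1Dx R (- 2^-1); rewrite ltrN2 invf_lt1 // ltr1n => /(_ isT).
  have -> : 1 + - 2^-1 = 2^-1 :> R by field.
  by rewrite lnV ?posrE // lerN2.
have ln4 : ln (2 ^+ 2) <= ln n%:R :> R.
  by rewrite ler_ln ?posrE ?exprn_gt0 ?ltr0n -?natrX ?ler_nat // (leq_trans _ n4).
by apply: le_trans ln4; rewrite lnXn // mulr2n; lra.
Qed.

(** * The proxy valuation of Case 2 *)

(* The items from position [k + 1] on are worth less than [1 / 2] in total and
   the first [k / 4 - 1] items less than [1 / 4 - 1 / k], which leaves more than
   [1 / 4 + 1 / k] for the [3 k / 4 + 1] positions in between. *)
Lemma quarter_value_ge (R : realType) (n k : nat) (v : 'I_n -> 'I_n -> R)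
  (sigma : 'I_n -> {perm 'I_n}) (i : 'I_n) :
  (0 < k)%N -> (4 %| k)%N -> (k <= n)%N -> unit_sum v -> consistent v sigma ->
  val_at (v i) (sigma i) 0 < k%:R^-1 ->
  val_at (v i) (sigma i) k < (2 * n%:R)^-1 ->
  (3 * k%:R)^-1 <= val_at (v i) (sigma i) (k %/ 4).-1.
Proof.
move=> k0 k4 kn [v0 v1] cons; set G := val_at (v i) (sigma i).
move=> top tail; rewrite leNgt; apply/negP => mid.
have mono p q : (p <= q)%N -> G q <= G p by apply: val_at_mono.
(* [q] is the 0-based rank of position [k / 4], hence also the number of positions before it. *)
have [q kq] : exists q, k = (4 * q.+1)%N.
  by exists (k %/ 4).-1; move/dvdnP: k4 k0 => [m ->]; lia.
have eq_q : (k %/ 4).-1 = q by rewrite kq; lia.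
rewrite eq_q in mid.
have := v1 i; rewrite -(sum_val_at R n (v i) (sigma i)) -/G.
rewrite (@big_cat_nat _ _ _ q) //=; last by lia.
rewrite (@big_cat_nat _ _ _ k q n) //=; last by lia.
have A1 : \sum_(0 <= p < q) G p <= (q%:R - 0%:R) * G 0%N.
  by apply: sum_block_le => // p _; apply: mono.
have A2 : \sum_(q <= p < k) G p <= (k%:R - q%:R) * G q.
  by apply: sum_block_le => [|p /andP[? _]]; [lia | apply: mono].
have A3 : \sum_(k <= p < n) G p <= (n%:R - k%:R) * G k.
  by apply: sum_block_le => // p /andP[? _]; apply: mono.
have kR : k%:R = 4 * (q%:R + 1) :> R by rewrite kq natrM natr1.
have k_gt0 : 0 < k%:R :> R by rewrite ltr0n.
have n_gt0 : 0 < n%:R :> R by rewrite ltr0n; lia.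
have nk : k%:R <= n%:R :> R by rewrite ler_nat.
have q0 : 0 <= q%:R :> R by rewrite ler0n.
have x0 : 0 < k%:R^-1 :> R by rewrite invr_gt0.
have kx : k%:R * k%:R^-1 = 1 :> R by rewrite divff // gt_eqF.
have tail' : n%:R * G k <= 2^-1.
  apply: le_trans (ler_wpM2l (ltW n_gt0) (ltW tail)) _.
  by rewrite invfM mulrCA divff ?gt_eqF // mulr1.
have Gk0 : 0 <= G k by apply: val_at_ge0.
rewrite invfM in mid.
move: A1 A2 A3 top mid tail' kx x0; set x := k%:R^-1.
set S1 := \sum_(_ <= _ < _) _; set S2 := \sum_(_ <= _ < _) _.
set S3 := \sum_(_ <= _ < _) _ => A1 A2 A3 top mid tail' kx x0 S.
have B1 : q%:R * G 0%N <= q%:R * x by rewrite ler_wpM2l // ltW.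
have B2 : (k%:R - q%:R) * G q <= (k%:R - q%:R) * (3^-1 * x).
  by rewrite ler_wpM2l ?(ltW mid) //; lra.
have B3 : 0 <= k%:R * G k by rewrite mulr_ge0 // ltW.
(* The three blocks total at most [q x + (3 q + 4) x / 3 + 1 / 2]. Since [1 / 2 = (2 q + 2) x], this
   falls short of 1 by [2 x / 3]. *)
rewrite kR in kx B2 A2; nra.
Qed.

(** Apart from the raised value, [vtilde] uses 0 or the true value of an item ranked no higher. The
    raised value is safe because [quarter_value_ge] bounds the last rank where it is used. *)
Lemma vtilde_le (R : realType) (n k : nat) (v : 'I_n -> 'I_n -> R)
  (sigma : 'I_n -> {perm 'I_n}) (i j : 'I_n) :
  (0 < k)%N -> (4 %| k)%N -> (k <= n)%N -> unit_sum v -> consistent v sigma ->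
  val_at (v i) (sigma i) 0 < k%:R^-1 -> vtilde k v sigma i j <= v i j.
Proof.
move=> k0 k4 kn us cons top; rewrite /vtilde.
have mono p q : (p <= q)%N -> val_at (v i) (sigma i) q <= val_at (v i) (sigma i) p.
  by apply: val_at_mono => // j'; apply: us.1.
rewrite -(val_at_rank R n (v i) (sigma i) j).
case: eqP => [-> //|_]; case: (leqP _ k) => [rk|_]; last first.
  by apply: val_at_ge0 => j'; apply: us.1.
case: ifP => [/andP[tail rq]|_]; last exact: mono.
apply: le_trans (quarter_value_ge _ _ _ _ _ i k0 k4 kn us cons top tail) _.
by apply: mono; lia.
Qed.

Lemma vtilde_ge0 (R : realType) (n k : nat) (v : 'I_n -> 'I_n -> R)
  (sigma : 'I_n -> {perm 'I_n}) (i j : 'I_n) :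
  unit_sum v -> 0 <= vtilde k v sigma i j.
Proof.
move=> us; have G0 p : 0 <= val_at (v i) (sigma i) p.
  by apply: val_at_ge0 => j'; apply: us.1.
rewrite /vtilde; do 3 case: ifP => // _.
by rewrite invr_ge0 mulr_ge0 ?ler0n.
Qed.

(** The first term pays for the top [k + 1] positions of agents with [u >= 1 / (2 n)]; the second
    pays for everything else. *)
Lemma value_le_vtilde (R : realType) (n k : nat) (v : 'I_n -> 'I_n -> R)
  (sigma : 'I_n -> {perm 'I_n}) (i j : 'I_n) :
  (0 < k)%N -> (4 %| k)%N -> n = (k ^ 3)%N -> unit_sum v -> consistent v sigma ->
  val_at (v i) (sigma i) 0 < k%:R^-1 ->
  v i j <= 2 * (k ^ 2)%:R * vtilde k v sigma i j
           + 12 / k%:R * \sum_j' vtilde k v sigma i j'.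
Proof.
move=> k0 k4 nk us cons top.
have kn : (k <= n)%N by rewrite nk -{1}(expn1 k) leq_pexp2l.
have vt0 j' := vtilde_ge0 R n k v sigma i j' us.
have S0 : 0 <= \sum_j' vtilde k v sigma i j' by rewrite sumr_ge0.
have k_gt0 : 0 < k%:R :> R by rewrite ltr0n.
set G := val_at (v i) (sigma i) in top *.
have mono p q : (p <= q)%N -> G q <= G p.
  by apply: val_at_mono => // j'; apply: us.1.
have vG : v i j = G (rank (sigma i) j) by rewrite /G val_at_rank.
have lt_k : v i j <= k%:R^-1 by rewrite vG (le_trans (mono 0%N _ _)) // ltW.
have k2 : 1 <= (k ^ 2)%:R :> R by rewrite ler1n expn_gt0 k0.
have nR : n%:R = (k ^ 2)%:R * k%:R :> R by rewrite -natrM nk -expnSr.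
have [tail|tail] := ltP (G k) (2 * n%:R)^-1.
  apply: le_trans lt_k _; rewrite -[leLHS]add0r lerD ?mulr_ge0 //.
  rewrite [12 / _]mulrC -mulrA -[leLHS]mulr1 ler_wpM2l ?invr_ge0 ?(ltW k_gt0) //.
  (* The first [k / 4] items have proxy value at least [1 / (3 k)] each, so [1 / 12] in total: this
     is the source of the constant 12. *)
  have := @top_block_le_sum R n (vtilde k v sigma i) (sigma i) (k %/ 4)%N
    (3 * k%:R)^-1.
  have -> : (k %/ 4)%N%:R * (3 * k%:R)^-1 = 12^-1 :> R.
    have -> : (k %/ 4)%N%:R = k%:R / 4 :> R.
      by rewrite -{2}(divnK k4) natrM mulfK ?pnatr_eq0.
    by field; rewrite gt_eqF.
  rewrite -ler_pdivrMl // mulr1; apply => // [|j' rj']; first by lia.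
  rewrite /vtilde -/G tail rj'; case: eqP => [_|_].
    apply: le_trans (quarter_value_ge _ _ _ _ _ i k0 k4 kn us cons top tail) _.
    exact: mono.
  by have -> : (rank (sigma i) j' <= k)%N by lia.
have [rk|kr] := leqP (rank (sigma i) j) k; last first.
  rewrite -[leLHS]add0r lerD ?mulr_ge0 //.
  apply: (@le_trans _ _ (k%:R^-1 * \sum_j' vtilde k v sigma i j')); last first.
    by rewrite ler_wpM2r // ler_peMl ?invr_ge0 ?(ltW k_gt0) // ler1n.
  (* The item is worth at most [G k], while each of the [k] items of rank below [k] has proxy value
     at least [G k]. *)
  apply: (@le_trans _ _ (G k)); first by rewrite vG mono // ltnW.
  rewrite ler_pdivlMl //.
  apply: (@top_block_le_sum R n _ (sigma i)) => // j' rj'.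
  rewrite /vtilde -/G ltNge tail /= (ltnW rj').
  by case: ifP => // _; apply: mono.
rewrite -[leLHS]addr0 lerD ?mulr_ge0 ?invr_ge0 ?(ltW k_gt0) //.
have vtG : G k <= vtilde k v sigma i j.
  rewrite /vtilde -/G ltNge tail /= rk.
  by case: ifP => // _; apply: mono.
apply: le_trans lt_k _.
(* As [n = k ^ 3], the factor [2 k ^ 2] turns [1 / (2 n)] into [1 / k]. *)
apply: (@le_trans _ _ (2 * (k ^ 2)%:R * (2 * n%:R)^-1)).
  rewrite nR le_eqVlt; apply/orP; left; apply/eqP; field.
  by rewrite !gt_eqF // (lt_le_trans _ k2).
by rewrite ler_wpM2l ?mulr_ge0 // (le_trans tail).
Qed.

(** * Distortion in the two cases *)

Lemma case1_distortion (R : realType) (n k : nat) (v : 'I_n -> 'I_n -> R)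
  (sigma : 'I_n -> {perm 'I_n}) (Q : seq ('I_n * 'I_n)) (y y' : {perm 'I_n}) :
  (0 < k)%N -> (4 <= n)%N -> n = (k ^ 3)%N -> unit_sum v -> consistent v sigma ->
  (exists i, k%:R^-1 <= val_at (v i) (sigma i) 0) ->
  @c1loop R n sigma (k%:R / Num.sqrt (ln n%:R)) 1 setT Q ->
  maximizes (revealed v (queries_at sigma 0 ++ Q)) y ->
  welfare v y' <= 3 * (k ^ 2)%:R * Num.sqrt (ln n%:R) * welfare v y.
Proof.
move=> k0 n4 nk us cons [i0 top] loop ymax.
have L1 := @ln_ge1 R n n4.
have SS : Num.sqrt (ln n%:R) ^+ 2 = ln n%:R :> R.
  by rewrite sqr_sqrtr // (le_trans ler01).
move: loop SS; set S := Num.sqrt _ => loop SS.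
have S_ge1 : 1 <= S by rewrite -(sqrtr1 R) ler_wsqrtr.
have S_gt0 : 0 < S by rewrite (lt_le_trans ltr01).
have k_gt0 : 0 < k%:R :> R by rewrite ltr0n.
have k1 : 1 <= k%:R :> R by rewrite ler1n.
have T_gt0 : 0 < k%:R / S by rewrite divr_gt0.
have leB P : uniq (map fst P) -> uniq (map snd P) -> {subset P <= Q} ->
    \sum_(q <- P) v q.1 q.2 <= welfare v y.
  move=> u1 u2 PQ; apply: partial_matching_le us.1 ymax u1 u2 _ => q qP.
  by rewrite mem_cat PQ ?orbT.
(* The top item of [i0] is queried, and this single pair already guarantees welfare [1 / k]. *)
have kB : 1 <= k%:R * welfare v y.
  rewrite -ler_pdivrMl // mulr1; apply: le_trans top _.
  have n0 : (0 < n)%N by apply: leq_trans n4.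
  pose j := sigma i0 (Ordinal n0).
  have rj : rank (sigma i0) j = 0%N by rewrite /j rank_perm.
  rewrite -{1}rj val_at_rank.
  have := @partial_matching_le R n v _ [:: (i0, j)] y us.1 ymax isT isT.
  rewrite big_seq1; apply => q; rewrite inE => /eqP ->.
  by rewrite mem_cat -{1}rj mem_queries_at.
have := c1loop_welfare R n v sigma y' _ _ _ _ _ T_gt0 us cons loop leB.
rewrite (eq_bigl xpredT) => [H|i]; last by rewrite inE.
apply: le_trans H _.
rewrite cardsT card_ord -mulr_sumr.
have harm : \sum_(1 <= h < n.+1) h%:R^-1 <= 2 * S ^+ 2 :> R.
  have nS := ltn_predK n4; rewrite -nS.
  by apply: le_trans (harmonic_le_ln R n.-1) _; rewrite nS SS; lra.
have -> : n%:R / (k%:R / S) = k%:R ^+ 2 * S.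
  by rewrite nk natrX; field; rewrite !gt_eqF.
apply: le_trans (lerD (lexx _) (ler_wpM2l (ltW T_gt0) harm)) _.
have -> : k%:R / S * (2 * S ^+ 2) = 2 * (k%:R * S) by field; rewrite gt_eqF.
(* Multiplying by [k * welfare v y >= 1] turns the additive cost [2 k S] of the positions into
   [2 k ^ 2 S * welfare v y]. With [k ^ 2 S * welfare v y] from the batches, the constant is 3. *)
have kS : k%:R * S <= k%:R * S * (k%:R * welfare v y).
  by rewrite ler_peMr // mulr_ge0 // ltW.
by rewrite natrX; lra.
Qed.

Lemma case2_distortion (R : realType) (n k : nat) (v : 'I_n -> 'I_n -> R)
  (sigma : 'I_n -> {perm 'I_n}) (y y' : {perm 'I_n}) :
  (0 < k)%N -> (4 %| k)%N -> n = (k ^ 3)%N -> unit_sum v -> consistent v sigma ->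
  (forall i, val_at (v i) (sigma i) 0 < k%:R^-1) ->
  maximizes (vtilde k v sigma) y ->
  welfare v y' <= 14 * (k ^ 2)%:R * welfare v y.
Proof.
move=> k0 k4 nk us cons top ymax.
have kn : (k <= n)%N by rewrite nk -{1}(expn1 k) leq_pexp2l.
have k_gt0 : 0 < k%:R :> R by rewrite ltr0n.
have k2 : 0 <= (k ^ 2)%:R :> R by rewrite ler0n.
have lew : welfare (vtilde k v sigma) y <= welfare v y.
  by apply: ler_sum => i _; apply: vtilde_le.
apply: (@le_trans _ _ (14 * (k ^ 2)%:R * welfare (vtilde k v sigma) y)); last first.
  by rewrite ler_wpM2l // mulr_ge0.
apply: (@le_trans _ _ (\sum_i (2 * (k ^ 2)%:R * vtilde k v sigma i (y' i)
           + 12 / k%:R * \sum_j' vtilde k v sigma i j'))).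
  by apply: ler_sum => i _; apply: value_le_vtilde.
rewrite big_split /= -!mulr_sumr.
have c2 : 0 <= 2 * (k ^ 2)%:R :> R by rewrite mulr_ge0.
have c12 : 0 <= 12 / k%:R :> R by rewrite divr_ge0 ?ltW.
(* The constant is 14 = 2 + 12: 2 from the optimality of [y] against [y'], and 12 from the average
   over matchings, where [n / k = k ^ 2]. *)
apply: le_trans (lerD (ler_wpM2l c2 (ymax y'))
  (ler_wpM2l c12 (maximizes_average R n _ y ymax))) _.
have -> : 12 / k%:R * (n%:R * welfare (vtilde k v sigma) y)
        = 12 * (k ^ 2)%:R * welfare (vtilde k v sigma) y.
  have -> : n%:R = k%:R ^+ 3 :> R by rewrite nk natrX.
  by rewrite natrX; field; rewrite gt_eqF.
by lra.
Qed.

Theorem theorem7 (R : realType) :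
  exists C : R, 0 < C /\
  forall (n k : nat), (0 < k)%N -> (4 %| k)%N -> n = (k ^ 3)%N ->
  forall (v : 'I_n -> 'I_n -> R) (sigma : 'I_n -> {perm 'I_n}),
    unit_sum v -> consistent v sigma ->
    forall (Q : seq ('I_n * 'I_n)) (y : {perm 'I_n}),
      FPA k v sigma Q y ->
      (forall i, (nqueries Q i <= 2)%N) /\
      (forall y' : {perm 'I_n},
         welfare v y' <= C * (k ^ 2)%:R * Num.sqrt (ln n%:R) * welfare v y).
Proof.
(* Case 1 gives the constant 3 and Case 2 gives 14. The bound of Case 2 lacks the factor
   [sqrt (ln n)], which is at least 1 because [4 %| k] forces [n >= 4]. *)
exists 14; split=> // n k k0 k4 nk v sigma us cons Q y.
have n4 : (4 <= n)%N.
  rewrite nk; apply: leq_trans (dvdn_leq k0 k4) _.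
  by rewrite -{1}(expn1 k) leq_pexp2l.
have S1 : 1 <= Num.sqrt (ln n%:R) :> R.
  by rewrite -[leLHS](sqrtr1 R) ler_wsqrtr ?ln_ge1.
have w0 : 0 <= welfare v y by apply: sumr_ge0 => i _; apply: us.1.
have kw0 : 0 <= (k ^ 2)%:R * welfare v y by rewrite mulr_ge0.
case=> [[top [Q1 [loop -> ymax]]]|[top [-> ymax]]]; split.
- move=> i; rewrite nqueries_cat (leq_add (nqueries_at_le1 _ _ _ _)) //.
  by apply: leq_trans (nqueries_c1loop _ _ _ _ _ _ _ i loop) _; rewrite leq_b1.
- move=> y'; apply: le_trans
    (case1_distortion R n k v sigma Q1 y y' k0 n4 nk us cons top loop ymax) _.
  by rewrite !ler_wpM2r // ?sqrtr_ge0 // ler_nat.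
- move=> i; rewrite nqueries_cat (leq_add (nqueries_at_le1 _ _ _ _)) //.
  exact: nqueries_at_le1.
- move=> y'; apply: le_trans
    (case2_distortion R n k v sigma y y' k0 k4 nk us cons top ymax) _.
  by rewrite ler_wpM2r // ler_peMr // mulr_ge0.
Qed.
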